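(* Let $\mathbb{K}$ be an algebraic extension of $\mathbb{Q}$ with ring of integers $\mathbb{Z}_{\mathbb{K}}$. Let $\lambda_1,\dots,\lambda_s,\gamma_1,\dots,\gamma_s\in\mathbb{Q}$ with $\gamma_1,\dots,\gamma_s$ pairwise distinct, and consider the differential operator $$D=\frac{d}{dz}+\frac{\lambda_1}{z-\gamma_1}+\dots+\frac{\lambda_s}{z-\gamma_s}$$ on $\mathbb{K}(z)$, with denominator $T(z)=(z-\gamma_1)\cdots(z-\gamma_s)$. Let $q$ be the product of the denominators of $\gamma_1,\dots,\gamma_s$, and let $b$ be the least common denominator of $\lambda_1,\dots,\lambda_s$. Then $D$ satisfies the factorial cancellation condition with constant $q\,b\,e^{\chi(b)}$: there exists a sequence of natural numbers $\{\psi_k\}_{k\in\mathbb{N}}$ such that for every $k\in\mathbb{N}$ and every $n=0,1,\dots,k$ the operator $\psi_k\,\dfrac{T(z)^nD^n}{n!}$ maps $\mathbb{Z}_{\mathbb{K}}[z]$ into $\mathbb{Z}_{\mathbb{K}}[z]$, and $\limsup_{k\to\infty}\psi_k^{1/k}\le q\,b\,e^{\chi(b)}$.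
   Context: The denominator of a rational number $x$ is the least $d\in\mathbb{N}$ with $dx\in\mathbb{Z}$. For $b\in\mathbb{N}$, $\chi(b)=\sum_{p\mid b}\frac{\log p}{p-1}$ over prime divisors $p$ of $b$. $D^n$ is the $n$-fold composition of $D$, and $T(z)^nD^n$ means $D^n$ followed by multiplication by $T(z)^n$. *)

(* Defs.v *)
From HB Require Import structures.
From mathcomp Require Import all_boot all_order all_algebra.
From mathcomp Require Import all_classical all_reals all_analysis.
From mathcomp Require Import ring lra.

Set Implicit Arguments.
Unset Strict Implicit.
Unset Printing Implicit Defensive.

Import Order.TTheory GRing.Theory Num.Theory.
Import numFieldNormedType.Exports.
Local Open Scope ring_scope.

Notation "x %:F" := (tofrac x) : ring_scope.

(* By [denomP] below, [denom x] is the least positive integer [d] such that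
   [d * x] is an integer; [lcdenomP] is the analogue for a family. *)
Definition denom (x : rat) : nat := `|denq x|%N.

Definition lcdenom (s : nat) (x : 'I_s -> rat) : nat :=
  \big[lcmn/1%N]_(i < s) denom (x i).

Lemma denomP (x : rat) (d : nat) :
  (d%:R * x \is a Num.int) = (denom x %| d)%N.
Proof.
apply/idP/idP => [|/dvdnP[c ->]]; last first.
  have dE : (denom x)%:R = (denq x)%:~R :> rat.
    by rewrite /denom natr_absz gtr0_norm ?denq_gt0.
  rewrite natrM dE -mulrA [_ * x]mulrC -numqE.
  by rewrite rpredM ?rpred_nat ?intr_int.
move=> /intrP[m]; rewrite -{1}(divq_num_den x) mulrA => dxE.
have den0 : (denq x)%:~R != 0 :> rat by rewrite intr_eq0 denq_neq0.
have {dxE} /eqP : d%:~R * (numq x)%:~R = m%:~R * (denq x)%:~R :> rat.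
  by rewrite -dxE mulfVK.
rewrite -!intrM eqr_int => /eqP/(congr1 absz); rewrite !abszM => E.
have : (denom x %| d * `|numq x|)%N by rewrite E dvdn_mull.
by rewrite Gauss_dvdl // coprime_sym coprime_num_den.
Qed.

Lemma lcdenomP (s : nat) (x : 'I_s -> rat) (d : nat) :
  reflect (forall i, d%:R * x i \is a Num.int) (lcdenom x %| d)%N.
Proof.
apply: (iffP (dvdn_biglcmP _ _ _)) => [H i | H i _].
  by rewrite denomP H.
by rewrite -denomP.
Qed.

Definition chi (R : realType) (b : nat) : R :=
  \sum_(p <- primes b) ln p%:R / (p%:R - 1).

Section RationalFunctions.
Variable K : fieldType.
Local Notation Kz := {fraction {poly K}}.

(* d/dz on K(z), by the quotient rule on the canonical representative. *)
Definition fracderiv (f : Kz) : Kz :=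
  let n := (frac (repr f)).1 in let d := (frac (repr f)).2 in
  (n^`() * d - n * d^`())%:F / (d ^+ 2)%:F.

Lemma fracderiv_div (n d : {poly K}) : d != 0 ->
  fracderiv (n%:F / d%:F) = (n^`() * d - n * d^`())%:F / (d ^+ 2)%:F.
Proof.
move=> d0; rewrite /fracderiv; set f := n%:F / d%:F.
set N := (frac (repr f)).1; set M := (frac (repr f)).2.
have M0 : M != 0 by exact: denom_ratioP.
have fE : f = N%:F / M%:F.
  rewrite -[LHS]reprK -[repr f]Ratio_numden -/N -/M.
  rewrite /FracField.tofrac; unlock.
  rewrite -[RHS]/(FracField.mul _ (FracField.inv _)) -FracField.pi_inv.
  rewrite -FracField.pi_mul; apply/eqP; rewrite FracField.equivf_def.
  rewrite /FracField.equivf /FracField.mulf /FracField.invf.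
  by rewrite !numden_Ratio ?oner_eq0 ?mulr1 ?mul1r // mulrC.
have E : N * d = n * M.
  apply/eqP; rewrite -tofrac_eq !tofracM; apply/eqP.
  move: fE; rewrite /f => /(congr1 (fun t => t * d%:F * M%:F)).
  rewrite mulfVK ?tofrac_eq0 // => ->.
  by rewrite mulrAC mulfVK ?tofrac_eq0.
have E' : N^`() * d + N * d^`() = n^`() * M + n * M^`().
  by rewrite -!derivM E.
apply/eqP; rewrite eqr_div ?tofrac_eq0 ?expf_neq0 //.
rewrite -!tofracM tofrac_eq; apply/eqP.
have -> : (N^`() * M - N * M^`()) * d ^+ 2 =
  (N^`() * d + N * d^`()) * M * d - (N * d) * (M^`() * d + M * d^`()).
  by rewrite expr2 !mulrDl !mulrDr; ring.
rewrite E' E; ring.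
Qed.

(* The ring of integers of [K] is the integral closure of the image of [int]. *)
Definition int_poly (p : {poly K}) : Prop :=
  forall i, integralOver (intr : int -> K) p`_i.

Definition preserves_int_poly (L : Kz -> Kz) : Prop :=
  forall p, int_poly p -> exists2 r, int_poly r & L p%:F = r%:F.

(* [psi] must be positive: the zero sequence would satisfy the rest trivially.
   The limsup is taken in the extended reals, so it is defined even when the
   sequence is unbounded; the [k = 0] term (equal to 1) does not affect it. *)
Definition factorial_cancellation (R : realType)
    (T : {poly K}) (D : Kz -> Kz) (C : R) : Prop :=
  exists psi : nat -> nat,
  [/\ forall k, (0 < psi k)%N,
      forall k n, (n <= k)%N ->
        preserves_int_poly
          (fun f => (psi k)%:R * (T%:F ^+ n * iter n D f / (n`!)%:R))
    & (limn_esup (fun k => ((psi k)%:R `^ (k%:R)^-1)%:E) <= C%:E)%E].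

(* [emb] is the embedding of the rationals into [K]. *)
Variables (emb : rat -> K) (s : nat) (lam gam : 'I_s -> rat).

Definition fuchs_op (f : Kz) : Kz :=
  fracderiv f
  + \sum_(i < s) (emb (lam i))%:P%:F / ('X - (emb (gam i))%:P)%:F * f.

Definition fuchs_den : {poly K} := \prod_(i < s) ('X - (emb (gam i))%:P).

End RationalFunctions.

(* Main.v *)
Require Import Defs.
From HB Require Import structures.
From mathcomp Require Import all_boot all_order all_algebra.
From mathcomp Require Import all_classical all_reals all_analysis.
From mathcomp Require Import ring.

Set Implicit Arguments.
Unset Strict Implicit.
Unset Printing Implicit Defensive.

Import Order.TTheory GRing.Theory Num.Theory.
Import numFieldNormedType.Exports.
Local Open Scope ring_scope.

(* Formally [D = u^-1 \o d/dz \o u] with [u = \prod_i (z - gamma_i)^lambda_i],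
   so Leibniz' rule expands [D^n / n!] into terms
   [f^(k_0) / k_0! * \prod_i binom(lambda_i, k_i) (z - gamma_i)^(- k_i)] with
   [k_0 + ... + k_s = n].  The factor [q^n T^n] clears the poles and the
   denominators of the [gamma_i].  The denominator of [binom(lambda_i, k_i)]
   divides [h(k_i)], where [h(m)] is [b^m] times the part of [m!] supported on
   the primes dividing [b], and [\prod_i h(k_i)] divides [h(n)] because
   multinomial coefficients are integers.  Hence [psi_k = q^k h(k)] works, and
   [v_p(k!) <= k / (p - 1)] gives [psi_k <= (q b e^chi(b))^k]. *)

(** * Generalized binomial coefficients and their denominators *)

Definition gbin (x : rat) (m : nat) : rat :=
  \prod_(i < m) (x - i%:R) / m`!%:R.

Lemma gbin0 x : gbin x 0 = 1.
Proof. by rewrite /gbin big_ord0 divr1. Qed.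

Lemma gbinS x m : m.+1%:R * gbin x m.+1 = (x - m%:R) * gbin x m.
Proof.
rewrite /gbin big_ord_recr /= factS natrM invfM.
field; rewrite pnatr_eq0 -lt0n fact_gt0.
by rewrite -[X in _ && (X + _ != _)]/(1%:R) -natrD pnatr_eq0.
Qed.

(** The power of [b] clears the numerators [x - i]; the partial factorial takes care of the primes
    at which [b] is not invertible. *)
Definition cancel_factor (b m : nat) : nat := (b ^ m * (m`!)`_\pi(b))%N.

Lemma cancel_factor_gt0 b m : (0 < b)%N -> (0 < cancel_factor b m)%N.
Proof. by move=> b0; rewrite muln_gt0 expn_gt0 b0 part_gt0. Qed.

(** Since binomial coefficients are integers, [m! (n - m)!] divides [n!], and taking [\pi(b)]-parts
    respects products and divisibility. *)
Lemma cancel_factorM_dvd b m n : (m <= n)%N ->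
  (cancel_factor b m * cancel_factor b (n - m) %| cancel_factor b n)%N.
Proof.
move=> mn; rewrite /cancel_factor mulnACA -expnD subnKC // dvdn_mul //.
rewrite -partnM ?fact_gt0 // partn_dvd ?fact_gt0 //.
by rewrite -(bin_fact mn) dvdn_mull.
Qed.

Lemma cancel_factor_dvd b m n : (m <= n)%N ->
  (cancel_factor b m %| cancel_factor b n)%N.
Proof.
by move=> /(cancel_factorM_dvd b); apply: dvdn_trans; rewrite dvdn_mulr.
Qed.

Lemma prod_subz_ffact (t m : nat) :
  \prod_(i < m) (t%:Z - i%:Z) = (t ^_ m)%:Z.
Proof.
elim: m => [|m IH]; first by rewrite big_ord0.
rewrite big_ord_recr /= IH ffactnSr PoszM.
have [mt|tm] := leqP m t; first by rewrite subzn.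
(* Truncated and integer subtraction differ here, but [t ^_ m] vanishes. *)
by rewrite ffact_small // !mul0r.
Qed.

(* Modulo [N], the progression is [b] times a run of consecutive integers. *)
Lemma dvdz_prod_progression (B : int) (b m N : nat) :
  (0 < N)%N -> coprime b N -> (N %| m`!)%N ->
  (N%:Z %| \prod_(i < m) (B - b%:Z * i%:Z))%Z.
Proof.
move=> N0 cop Nm.
have [[u v] /= uv] : exists uv : int * int, uv.1 * b%:Z + uv.2 * N%:Z = 1.
  by apply/coprimezP; rewrite coprimezE.
(* As [u] inverts [b] modulo [N], the residue of [u * B] solves [b * t = B] modulo [N]; being
   nonnegative, it can enter a falling factorial. *)
pose t := absz ((u * B) %% N%:Z)%Z.
have N0' : N%:Z != 0 :> int by rewrite eqz_nat -lt0n.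
have tE : t%:Z = ((u * B) %% N%:Z)%Z by rewrite /t gez0_abs // modz_ge0.
have bt : (N%:Z %| B - b%:Z * t%:Z)%Z.
  apply/dvdzP; exists (v * B + b%:Z * ((u * B) %/ N%:Z)%Z).
  have := divz_eq (u * B) N%:Z; rewrite -tE => E.
  have -> : b%:Z * t%:Z = b%:Z * (u * B) - b%:Z * (u * B %/ N%:Z)%Z * N%:Z.
    by rewrite {1}E; ring.
  by rewrite -[X in X - _](mulr1 B) -uv; ring.
have dvd_diff : (N%:Z %| \prod_(i < m) (B - b%:Z * i%:Z)
                         - \prod_(i < m) (b%:Z * (t%:Z - i%:Z)))%Z.
  elim/big_rec2: _ => [|i y x _ IH]; first by rewrite subrr dvdz0.
  set p := B - _.
  have -> : p * x - b%:Z * (t%:Z - i%:Z) * y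
          = p * (x - y) + (B - b%:Z * t%:Z) * y by rewrite /p; ring.
  by apply: rpredD; [apply: dvdz_mull | apply: dvdz_mulr].
rewrite -(subrK (\prod_(i < m) (b%:Z * (t%:Z - i%:Z))) (\prod_(i < m) _)).
(* The second product is a power of [b] times [t ^_ m], that is, a binomial coefficient times [m!],
   which [N] divides. *)
rewrite rpredD // big_split /= prod_subz_ffact -bin_ffact PoszM.
by apply/dvdz_mull/dvdz_mull.
Qed.

(** The factor [b ^ m] turns the numerator of [gbin x m] into the product of the [B - b i],
    divisible by the part of [m!] prime to [b]. The complementary part of [m!] is the other factor
    of [cancel_factor]. *)
Lemma cancel_factor_gbin_int (b m : nat) (x : rat) :
  (0 < b)%N -> b%:R * x \is a Num.int ->
  (cancel_factor b m)%:R * gbin x m \is a Num.int.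
Proof.
move=> b0 /intrP[B BE].
have := dvdz_prod_progression B (b := b) (m := m)
  (N := (m`!)`_\pi(b)^') (part_gt0 _ _).
rewrite -{1}(part_pnat_id (pnat_pi b0)) coprime_partC dvdn_part.
move=> /(_ isT isT) /dvdzP[z zE].
move: zE; set P := ((m`!)`_\pi(b))%N; set N := ((m`!)`_\pi(b)^')%N => zE.
have factE : m`!%:R = P%:R * N%:R :> rat by rewrite -natrM partnC // fact_gt0.
have prodE : b%:R ^+ m * \prod_(i < m) (x - i%:R) = z%:~R * N%:R.
  rewrite -[X in _ ^+ X](card_ord m) -prodr_const -big_split /=.
  have -> : z%:~R * N%:R = (z * N%:Z)%:~R :> rat by rewrite intrM.
  rewrite -zE rmorph_prod /=; apply: eq_bigr => i _.
  by rewrite mulrBr BE intrB intrM.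
apply/intrP; exists z.
have P0 : P%:R != 0 :> rat by rewrite pnatr_eq0 -lt0n part_gt0.
have N0 : N%:R != 0 :> rat by rewrite pnatr_eq0 -lt0n part_gt0.
rewrite /cancel_factor /gbin natrM natrX factE -/P invfM.
transitivity
  (b%:R ^+ m * \prod_(i < m) (x - i%:R) * (P%:R * P%:R^-1) * N%:R^-1).
  by ring.
by rewrite prodE mulfV // mulr1 mulfK.
Qed.

(** * Growth of the cancelling factor *)

Lemma logn_fact_bound (p n : nat) : prime p -> (p.-1 * logn p n`! <= n)%N.
Proof.
move=> p_pr; rewrite logn_fact //.
(* Legendre's sum is cut off at [k]. The extra term makes the induction close, because
   [p * (n %/ p ^ k.+1) <= n %/ p ^ k]. *)
suff H k : (p.-1 * (\sum_(1 <= i < k.+1) n %/ p ^ i) + n %/ p ^ k <= n)%N.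
  by apply: leq_trans (H n); rewrite leq_addr.
elim: k => [|k IH]; first by rewrite big_nil muln0 expn0 divn1.
rewrite big_nat_recr //= mulnDr -addnA; apply: leq_trans IH.
rewrite leq_add2l -{2}(mul1n (n %/ _)%N) -mulnDl addn1 prednK ?prime_gt0 //.
by rewrite expnSr divnMA mulnC leq_trunc_div.
Qed.

Lemma partn_primes (b n : nat) :
  (n`_\pi(b) = \prod_(p <- primes b) p ^ logn p n)%N.
Proof.
(* Primes dividing [b] may exceed [n], so the range is widened to [n + b]. *)
rewrite (widen_partn _ (leq_addr b n)) -big_filter; apply: perm_big.
apply: uniq_perm; rewrite ?filter_uniq ?iota_uniq ?primes_uniq // => p.
rewrite mem_filter mem_index_iota; apply: andb_idr => /=.
rewrite inE /= mem_primes => /and3P[_ b0 /dvdn_leq-/(_ b0) pb].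
by rewrite ltnS (leq_trans pb) ?leq_addl.
Qed.

Lemma cancel_factor_le (R : realType) (b k : nat) :
  (cancel_factor b k)%:R <= (b%:R * expR (chi R b)) ^+ k :> R.
Proof.
rewrite /cancel_factor natrM natrX exprMn ler_wpM2l ?exprn_ge0 //.
rewrite partn_primes natr_prod -expRM_natl /chi mulr_sumr expR_sum.
rewrite !big_seq; apply: ler_prod => p; rewrite mem_primes => /andP[p_pr _].
rewrite ler0n /= natrX.
have p1 : 1 < p%:R :> R by rewrite ltr1n prime_gt1.
have p0 : 0 < p%:R :> R by rewrite ltr0n prime_gt0.
(* The bound holds prime by prime after taking logarithms: [v_p(k!) log p <= k log p / (p - 1)]. *)
rewrite -[X in X ^+ _](lnK (x := p%:R)) ?posrE // -expRM_natl ler_expR.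
rewrite mulrCA [X in X <= _]mulrC ler_wpM2l ?ln_ge0 ?(ltW p1) //.
rewrite ler_pdivlMr ?subr_gt0 //.
have -> : p%:R - 1 = p.-1%:R :> R by rewrite -subn1 natrB ?prime_gt0.
by rewrite mulrC -natrM ler_nat logn_fact_bound.
Qed.

(** * Divided powers of twisted derivations *)

Section DividedPowers.
Variables (F : fieldType) (iota : {rmorphism rat -> F}).

Definition dpow (D : F -> F) (n : nat) (f : F) : F := iter n D f / n`!%:R.

(** The morphism from [rat] forces characteristic zero. *)
Lemma natf_neq0 n : (n.+1%:R : F) != 0.
Proof. by rewrite -(rmorph_nat iota) fmorph_eq0 pnatr_eq0. Qed.

Variable delta : F -> F.
Hypothesis deltaM : forall f g, delta (f * g) = delta f * g + f * delta g.
Hypothesis delta_iota : forall a, delta (iota a) = 0.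

(** A zero-order term spoils the product rule for [D] itself; this weaker rule, that of a connection
    over [delta], survives adding such terms. *)
Definition leibniz_over (D : F -> F) : Prop :=
  forall c f, D (c * f) = delta c * f + c * D f.

Lemma dpowS D n f : leibniz_over D ->
  D (dpow D n f) = n.+1%:R * dpow D n.+1 f.
Proof.
move=> DM; have deltaVfact : delta (n`!%:R^-1) = 0.
  by rewrite -(rmorph_nat iota) -fmorphV delta_iota.
rewrite /dpow mulrC DM deltaVfact mul0r add0r factS natrM invfM iterS.
by rewrite mulrCA mulVKf ?natf_neq0 // mulrC.
Qed.

Lemma delta_exp y m : delta y = - y ^+ 2 ->
  delta (y ^+ m) = - (m%:R * y ^+ m.+1).
Proof.
move=> dy; elim: m => [|m IH].
  by rewrite expr0 -(rmorph1 iota) delta_iota mul0r oppr0.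
by rewrite exprS deltaM dy IH -natr1 !exprS; ring.
Qed.

(* [y] plays the role of [1 / (z - gamma)]: formally the twisted operator is
   [y^lam \o D \o y^(-lam)], and this is the Leibniz rule for its divided
   powers. *)
Lemma dpow_twist (D : F -> F) (lam : rat) (y : F) (n : nat) (f : F) :
  {morph D : f g / f + g} -> leibniz_over D -> delta y = - y ^+ 2 ->
  dpow (fun g => D g + iota lam * y * g) n f =
  \sum_(m < n.+1) iota (gbin lam m) * y ^+ m * dpow D (n - m) f.
Proof.
move=> DD DM dy; set D' := fun g => _.
have D0 : D 0 = 0 by apply: (addrI (D 0)); rewrite -DD !addr0.
have D'M : leibniz_over D' by move=> c g; rewrite /D' DM; ring.
elim: n => [|n IH].
  by rewrite big_ord1 gbin0 rmorph1 !mul1r.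
(* After multiplication by [n.+1] the left side is [D'] applied to the induction hypothesis. *)
apply: (mulfI (natf_neq0 n)); rewrite -dpowS // IH.
rewrite /D' (big_morph _ DD D0) mulr_sumr -big_split /=.
pose c m := iota (gbin lam m).
have cS m : m.+1%:R * c m.+1 = (iota lam - m%:R) * c m.
  by rewrite /c -!(rmorph_nat iota) -rmorphB -!rmorphM gbinS.
(* Differentiating [y ^+ m] contributes [- m] and the twist contributes [lam]; together they raise
   the binomial coefficient by [cS]. *)
transitivity (\sum_(m < n.+1)
   (m.+1%:R * c m.+1 * y ^+ m.+1 * dpow D (n - m) f
    + (n.+1 - m)%:R * c m * y ^+ m * dpow D (n.+1 - m) f)).
  apply: eq_bigr => m _; have mn : (m <= n)%N by rewrite -ltnS.
  rewrite -/(c m) DM deltaM {1}/c delta_iota mul0r add0r.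
  rewrite delta_exp // dpowS // cS subSn // !exprS; ring.
rewrite big_split /= mulr_sumr.
(* On the right, [n.+1] is split as [m + (n.+1 - m)]. The first half vanishes at [m = 0] and the
   second at [m = n.+1], which matches the two shifted sums. *)
transitivity (\sum_(m < n.+2)
   (m%:R * c m * y ^+ m * dpow D (n.+1 - m) f
    + (n.+1 - m)%:R * c m * y ^+ m * dpow D (n.+1 - m) f)); last first.
  apply: eq_bigr => m _; rewrite -/(c m) -!mulrA -mulrDl -natrD subnKC //.
  by rewrite -ltnS.
rewrite big_split /=; congr (_ + _).
  by rewrite [RHS]big_ord_recl !mul0r add0r.
by rewrite [RHS]big_ord_recr /= subnn !mul0r addr0.
Qed.

End DividedPowers.

(** * The derivation of [K(z)] *)

(** Treating derivatives as independent letters reduces the rules for [fracderiv] to identities of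
    rational functions. *)
Lemma quotient_ruleD (F : fieldType) (n n' d d' m m' e e' : F) :
  d != 0 -> e != 0 ->
  ((n' * e + n * e' + (m' * d + m * d')) * (d * e)
     - (n * e + m * d) * (d' * e + d * e')) / (d * e) ^+ 2
  = (n' * d - n * d') / d ^+ 2 + (m' * e - m * e') / e ^+ 2.
Proof. by move=> d0 e0; field; rewrite d0 e0. Qed.

Lemma quotient_ruleM (F : fieldType) (n n' d d' m m' e e' : F) :
  d != 0 -> e != 0 ->
  ((n' * m + n * m') * (d * e) - n * m * (d' * e + d * e')) / (d * e) ^+ 2
  = (n' * d - n * d') / d ^+ 2 * (m / e)
    + n / d * ((m' * e - m * e') / e ^+ 2).
Proof. by move=> d0 e0; field; rewrite d0 e0. Qed.

Section FracDeriv.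
Variable K : fieldType.
Local Notation Kz := {fraction {poly K}}.
Local Notation toK := (intr : {rmorphism int -> K}).

Lemma fracE (f : Kz) : exists n d : {poly K}, d != 0 /\ f = n%:F / d%:F.
Proof.
set n := (frac (repr f)).1; set d := (frac (repr f)).2.
have d0 : d != 0 by exact: denom_ratioP.
exists n, d; split => //.
rewrite -[LHS]reprK -[repr f]Ratio_numden -/n -/d.
rewrite /FracField.tofrac; unlock.
rewrite -[RHS]/(FracField.mul _ (FracField.inv _)) -FracField.pi_inv.
rewrite -FracField.pi_mul; apply/eqP; rewrite FracField.equivf_def.
rewrite /FracField.equivf /FracField.mulf /FracField.invf.
by rewrite !numden_Ratio ?oner_eq0 ?mulr1 ?mul1r // mulrC.
Qed.

Lemma fracderiv_tofrac (p : {poly K}) : fracderiv p%:F = p^`()%:F.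
Proof.
have := fracderiv_div p (oner_neq0 {poly K}).
by rewrite tofrac1 divr1 derivC mulr0 subr0 mulr1 expr1n tofrac1 divr1.
Qed.

Lemma fracderivD : {morph @fracderiv K : f g / f + g}.
Proof.
move=> f g; have [n [d [d0 ->]]] := fracE f; have [m [e [e0 ->]]] := fracE g.
have dF : d%:F != 0 :> Kz by rewrite tofrac_eq0.
have eF : e%:F != 0 :> Kz by rewrite tofrac_eq0.
have -> : n%:F / d%:F + m%:F / e%:F = (n * e + m * d)%:F / (d * e)%:F :> Kz.
  by rewrite tofracD !tofracM (addf_div _ _ dF eF).
rewrite (fracderiv_div _ (mulf_neq0 d0 e0)).
rewrite (fracderiv_div _ d0) (fracderiv_div _ e0) derivD !derivM.
rewrite !tofracXn !(tofracB, tofracD, tofracM).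
exact: (quotient_ruleD _ _ _ _ _ _ dF eF).
Qed.

Lemma fracderivM (f g : Kz) :
  fracderiv (f * g) = fracderiv f * g + f * fracderiv g.
Proof.
have [n [d [d0 ->]]] := fracE f; have [m [e [e0 ->]]] := fracE g.
have dF : d%:F != 0 :> Kz by rewrite tofrac_eq0.
have eF : e%:F != 0 :> Kz by rewrite tofrac_eq0.
have -> : n%:F / d%:F * (m%:F / e%:F) = (n * m)%:F / (d * e)%:F :> Kz.
  by rewrite !tofracM (mulf_div n%:F d%:F m%:F e%:F).
rewrite (fracderiv_div _ (mulf_neq0 d0 e0)).
rewrite (fracderiv_div _ d0) (fracderiv_div _ e0) !derivM.
rewrite !tofracXn !(tofracB, tofracD, tofracM).
exact: (quotient_ruleM _ _ _ _ _ _ dF eF).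
Qed.

(** This makes [1 / (z - c)] admissible as the [y] of [dpow_twist]. *)
Lemma fracderiv_invXsubC (c : K) :
  fracderiv ('X - c%:P)%:F^-1 = - (('X - c%:P)%:F^-1) ^+ 2.
Proof.
rewrite -[X in fracderiv X]mul1r -tofrac1 fracderiv_div ?polyXsubC_eq0 //.
rewrite derivC derivXsubC mul0r mul1r sub0r tofracN tofrac1 tofracXn.
by rewrite mulN1r exprVn.
Qed.

(** * Integral polynomials as a subring of [K(z)] *)

Definition int_frac (f : Kz) : Prop := exists2 r, int_poly r & f = r%:F.

Lemma int_frac_tofrac p : int_poly p -> int_frac p%:F.
Proof. by exists p. Qed.

Lemma int_fracD f g : int_frac f -> int_frac g -> int_frac (f + g).
Proof.
move=> [p ip ->] [r ir ->]; exists (p + r); last by rewrite tofracD.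
by move=> i; rewrite coefD; apply: integral_add.
Qed.

Lemma int_fracM f g : int_frac f -> int_frac g -> int_frac (f * g).
Proof.
move=> [p ip ->] [r ir ->]; exists (p * r); last by rewrite tofracM.
move=> i; rewrite coefM.
apply: (big_ind (integralOver (intr : int -> K))) => [||j _].
- exact: (mxpoly.integral0 toK).
- exact: integral_add.
- exact: integral_mul.
Qed.

Lemma int_frac_int (z : int) : int_frac z%:~R.
Proof.
exists (z%:~R)%:P; last by rewrite !rmorph_int.
move=> i; rewrite coefC; case: ifP => _; first exact: (integral_id toK).
exact: (mxpoly.integral0 toK).
Qed.

Lemma int_frac_nat (n : nat) : int_frac n%:R.
Proof. exact: (int_frac_int n). Qed.

Lemma int_fracX f n : int_frac f -> int_frac (f ^+ n).
Proof.
move=> intf; elim: n => [|n IH]; first exact: (int_frac_nat 1).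
by rewrite exprS; apply: int_fracM.
Qed.

Lemma int_frac_sum (I : Type) (r : seq I) (f : I -> Kz) :
  (forall i, int_frac (f i)) -> int_frac (\sum_(i <- r) f i).
Proof.
move=> intf; apply: (big_ind int_frac) => //; first exact: (int_frac_nat 0).
exact: int_fracD.
Qed.

End FracDeriv.

(** Of the [n] factors [d * x], [m] are spent on the pole [x^-1 ^+ m] and leave [d ^+ m]; the other
    [n - m] stay. The powers of [Q] split in the same way, so that the last bracket has the shape of
    an induction hypothesis at [n - m]. *)
Lemma twisted_term (F : fieldType) (e h1 h2 d x Q c G : F) (m n : nat) :
  x != 0 -> (m <= n)%N ->
  e * (h1 * h2) * (d * x * Q) ^+ n * (c * x^-1 ^+ m * G)
  = e * (h1 * c) * (d ^+ m * Q ^+ m * (d * x) ^+ (n - m))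
    * (h2 * Q ^+ (n - m) * G).
Proof.
move=> x0 /subnKC nE; rewrite -{1}nE !exprMn !exprD exprVn.
by field; rewrite expf_neq0.
Qed.

(** * Integrality of the divided powers of the Fuchsian operator *)

Section FuchsOp.
Variables (K : fieldType) (emb : {rmorphism rat -> K}).
Local Notation Kz := {fraction {poly K}}.
Local Notation toK := (intr : {rmorphism int -> K}).

Definition ratfrac : rat -> Kz := @tofrac {poly K} \o polyC \o emb.
HB.instance Definition _ := GRing.RMorphism.on ratfrac.

Lemma fracderiv_ratfrac a : fracderiv (ratfrac a) = 0.
Proof. by rewrite /ratfrac /= fracderiv_tofrac derivC tofrac0. Qed.

Lemma iter_fracderiv n (p : {poly K}) :
  iter n (@fracderiv K) p%:F = p^`(n)%:F.
Proof. by elim: n => //= n ->; rewrite fracderiv_tofrac. Qed.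

Lemma dpow_fracderiv n (p : {poly K}) :
  dpow (@fracderiv K) n p%:F = p^`N(n)%:F.
Proof.
rewrite /dpow iter_fracderiv nderivn_def tofracMn -[X in X / _]mulr_natr.
rewrite mulfK //.
by rewrite -(prednK (fact_gt0 n)) (natf_neq0 ratfrac).
Qed.

(** Dividing the [n]-th derivative by [n!] leaves only binomial coefficients as multipliers. *)
Lemma int_poly_nderivn n (p : {poly K}) : int_poly p -> int_poly p^`N(n).
Proof.
move=> ip i; rewrite coef_nderivn -mulr_natr.
by apply: integral_mul => //; exact: (integral_nat toK).
Qed.

Lemma int_frac_ratfrac a : a \is a Num.int -> int_frac (ratfrac a).
Proof. by move=> /intrP[z ->]; rewrite rmorph_int; apply: int_frac_int. Qed.

Lemma int_frac_denXsubC (c : rat) :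
  int_frac ((denom c)%:R * ('X - (emb c)%:P)%:F).
Proof.
have -> : (denom c)%:R * ('X - (emb c)%:P)%:F
        = (denom c)%:R * 'X%:F + - 1%:~R * ratfrac ((denom c)%:R * c).
  by rewrite rmorphM rmorph_nat tofracB /ratfrac /=; ring.
apply: int_fracD; apply: int_fracM; first exact: int_frac_nat.
- apply: int_frac_tofrac => i; rewrite coefX; exact: (integral_nat toK).
- by rewrite -rmorphN; apply: int_frac_int.
- by apply: int_frac_ratfrac; rewrite denomP.
Qed.

Variables (s : nat) (lam gam : 'I_s -> rat).
Local Notation x i := ('X - (emb (gam i))%:P)%:F.

(** Summing over a list allows induction on the singular points, adding one pole at a time. *)
Definition fuchs_seq (l : seq 'I_s) (f : Kz) : Kz :=
  fracderiv f + \sum_(i <- l) ratfrac (lam i) / x i * f.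

Lemma fuchs_seqD l : {morph fuchs_seq l : f g / f + g}.
Proof.
by move=> f g; rewrite /fuchs_seq fracderivD -!mulr_suml mulrDr addrACA.
Qed.

Lemma fuchs_seq_leibniz l : leibniz_over (@fracderiv K) (fuchs_seq l).
Proof. by move=> c f; rewrite /fuchs_seq fracderivM -!mulr_suml; ring. Qed.

Lemma fuchs_seq_cons i l (f : Kz) :
  fuchs_seq (i :: l) f = fuchs_seq l f + ratfrac (lam i) / x i * f.
Proof. by rewrite /fuchs_seq big_cons; ring. Qed.

(** Each new pole is a twist, expanded by [dpow_twist]. In the term of index [m],
    [cancel_factor b m] clears the binomial coefficient and [cancel_factor b (n - m)] serves the
    shorter list; hence the induction is uniform in [n]. *)
Lemma dpow_fuchs_int (b : nat) (l : seq 'I_s) (n : nat) (p : {poly K}) :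
  (0 < b)%N -> (forall i, b%:R * lam i \is a Num.int) -> int_poly p ->
  int_frac ((cancel_factor b n)%:R
    * (\prod_(i <- l) ((denom (gam i))%:R * x i)) ^+ n
    * dpow (fuchs_seq l) n p%:F).
Proof.
move=> b0 blam ip; elim: l n => [|i l IH] n.
  have -> : fuchs_seq [::] = @fracderiv K.
    by apply/funext => f; rewrite /fuchs_seq big_nil addr0.
  rewrite big_nil expr1n mulr1 dpow_fracderiv.
  apply: int_fracM; first exact: int_frac_nat.
  exact/int_frac_tofrac/int_poly_nderivn.
have -> : fuchs_seq (i :: l) =
    fun f => fuchs_seq l f + ratfrac (lam i) * (x i)^-1 * f.
  by apply/funext => f; rewrite fuchs_seq_cons.
rewrite (dpow_twist (delta := @fracderiv K)) //; first last.
- exact: fracderiv_invXsubC.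
- exact: fuchs_seq_leibniz.
- exact: fuchs_seqD.
- exact: fracderiv_ratfrac.
- exact: fracderivM.
rewrite big_cons; set d := denom (gam i); set Q := \prod_(j <- l) _.
rewrite mulr_sumr; apply: int_frac_sum => m.
have mn : (m <= n)%N by rewrite -ltnS.
have [e eE] := dvdnP (cancel_factorM_dvd b mn).
have x0 : x i != 0 :> Kz by rewrite tofrac_eq0 polyXsubC_eq0.
have Qint : int_frac Q.
  rewrite /Q; apply: (big_ind (@int_frac K)) => [||j _].
  - exact: (int_frac_nat K 1).
  - exact: int_fracM.
  - exact: int_frac_denXsubC.
have -> : (cancel_factor b n)%:R * (d%:R * x i * Q) ^+ n *
    (ratfrac (gbin (lam i) m) * (x i)^-1 ^+ m * dpow (fuchs_seq l) (n - m) p%:F)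
  = e%:R * ratfrac ((cancel_factor b m)%:R * gbin (lam i) m)
    * (d%:R ^+ m * Q ^+ m * (d%:R * x i) ^+ (n - m))
    * ((cancel_factor b (n - m))%:R * Q ^+ (n - m)
       * dpow (fuchs_seq l) (n - m) p%:F).
  by rewrite (rmorphM ratfrac _%:R) rmorph_nat eE !natrM twisted_term.
apply: int_fracM (IH _); apply: int_fracM.
  apply: int_fracM; first exact: int_frac_nat.
  exact/int_frac_ratfrac/cancel_factor_gbin_int.
apply: int_fracM; last exact/int_fracX/int_frac_denXsubC.
by apply: int_fracM; apply: int_fracX; first exact: int_frac_nat.
Qed.

End FuchsOp.

(** * The limit superior and the choice of [psi] *)

Lemma limn_esup_le_eventually (R : realType) (u : (\bar R)^nat) (l : \bar R) :
  (forall n, (0 < n)%N -> (u n <= l)%E) -> (limn_esup u <= l)%E.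
Proof.
move=> ul; rewrite /limn_esup limf_esupE; apply: ge_ereal_inf.
(* The limsup is an infimum of suprema over neighbourhoods of infinity, and the positive indices
   form one. *)
exists (ereal_sup (u @` [set n : nat | (0 < n)%N])%classic); last first.
  by apply: ge_ereal_sup => _ [n n0 <-]; apply: ul.
by exists [set n : nat | (0 < n)%N]%classic => //; exists 1%N.
Qed.

Theorem theorem2 (R : realType) (K : fieldType) (emb : {rmorphism rat -> K})
    (algK : forall x : K, algebraicOver emb x)
    (s : nat) (lam gam : 'I_s -> rat) (gam_inj : injective gam) :
  let q := (\prod_(i < s) denom (gam i))%N in
  let b := lcdenom lam in
  factorial_cancellation (fuchs_den emb gam) (fuchs_op emb lam gam)
    (q%:R * b%:R * expR (chi R b)).
Proof.
move=> q b.
have q0 : (0 < q)%N by apply: prodn_gt0 => i; rewrite absz_gt0 denq_neq0.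
have b0 : (0 < b)%N.
  apply: (big_ind (fun n => 0 < n)%N) => // [m n m0 n0|i _].
    by rewrite lcmn_gt0 m0.
  by rewrite absz_gt0 denq_neq0.
have blam i : b%:R * lam i \is a Num.int by apply: (elimT (lcdenomP _ _)).
(* For [n <= k], the surplus over the factor required at [n] is the integer [q ^ (k - n) * e], where
   [e] is the quotient of the cancelling factors. *)
exists (fun k => q ^ k * cancel_factor b k)%N; split => [k|k n nk p ip|].
- by rewrite muln_gt0 expn_gt0 q0 cancel_factor_gt0.
- have [e eE] := dvdnP (cancel_factor_dvd b nk).
  have := dpow_fuchs_int emb gam (index_enum 'I_s) n b0 blam ip.
  rewrite big_split /= => H.
  suff -> : (q ^ k * cancel_factor b k)%:R *
      ((fuchs_den emb gam)%:F ^+ n * iter n (fuchs_op emb lam gam) p%:F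
       / n`!%:R)
    = (q ^ (k - n) * e)%:R * ((cancel_factor b n)%:R *
      (\prod_(i < s) (denom (gam i))%:R
       * \prod_(i < s) ('X - (emb (gam i))%:P)%:F) ^+ n
      * dpow (fuchs_seq emb lam gam (index_enum 'I_s)) n p%:F)
      :> {fraction {poly K}}.
    by apply: int_fracM H; apply: int_frac_nat.
  (* Over the full enumeration of indices the two operators agree by conversion. *)
  have -> : fuchs_seq emb lam gam (index_enum 'I_s) = fuchs_op emb lam gam.
    by [].
  have -> : \prod_(i < s) (denom (gam i))%:R = q%:R :> {fraction {poly K}}.
    by rewrite natr_prod.
  rewrite -(rmorph_prod (@tofrac _)) -/(fuchs_den emb gam) eE.
  move: (cancel_factor b n) => h.
  rewrite -{1}(subnK nk) expnD !natrM [(q ^ n)%:R]natrX exprMn /dpow; ring.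
- apply: limn_esup_le_eventually => k k0; rewrite lee_fin.
  have C0 : 0 <= q%:R * b%:R * expR (chi R b) by rewrite !mulr_ge0 ?expR_ge0.
  have le_k : (q ^ k * cancel_factor b k)%:R
      <= (q%:R * b%:R * expR (chi R b)) ^+ k.
    rewrite natrM natrX -mulrA exprMn ler_wpM2l ?exprn_ge0 //.
    exact: cancel_factor_le.
  apply: (@le_trans _ _ (((q%:R * b%:R * expR (chi R b)) ^+ k) `^ (k%:R^-1))).
    by rewrite ge0_ler_powR ?nnegrE ?invr_ge0 ?exprn_ge0.
  (* The exponents [k] and [k^-1] cancel because [k] is positive. *)
  by rewrite -powR_mulrn // -powRrM mulfV ?pnatr_eq0 -?lt0n // powRr1.
Qed.
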